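(* Let $\Gamma$ be a countable group, let $\bm{d}=\Gamma\curvearrowright^d(Y,\nu)$ be a measure preserving action of $\Gamma$, and suppose $\pi:(Y,\nu)\to(Z,\eta)$ is a factor map from $\bm{d}$ onto an identity action $\Gamma\curvearrowright^{\iota_\eta}(Z,\eta)$, where $(Z,\eta)$ is a standard probability space. Let $\nu=\int_Z\nu_z\,d\eta(z)$ be the disintegration of $\nu$ with respect to $\pi$ and let $\bm{d}_z=\Gamma\curvearrowright^d(Y,\nu_z)$. Suppose that $\bm{a}=\Gamma\curvearrowright^a(X,\mu)$ is an ergodic measure preserving action of $\Gamma$ that is weakly contained in $\bm{d}$. Then $\bm{a}$ is weakly contained in $\bm{d}_z$ for $\eta$-almost every $z\in Z$.
   Context: A measure preserving action $\bm{a}=\Gamma\curvearrowright^a(X,\mu)$ of a countable group $\Gamma$ is a Borel action $a$ of $\Gamma$ on a standard Borel space $X$ preserving a Borel probability measure $\mu$ on $X$. The identity action $\iota_\eta$ fixes every point of $Z$. For $\eta$-almost every $z$ the measure $\nu_z$ is $d$-invariant, so $\bm{d}_z$ is a measure preserving action. Weak containment: for $\bm{a}$ on $(X,\mu)$ and $\bm{b}$ on $(Y,\nu)$, $\bm{a}\prec\bm{b}$ means that for every finite Borel partition $A_0,\dots,A_{k-1}$ of $X$, every finite $F\subseteq\Gamma$, and every $\epsilon>0$ there is a Borel partition $B_0,\dots,B_{k-1}$ of $Y$ with $|\mu(\gamma^aA_i\cap A_j)-\nu(\gamma^bB_i\cap B_j)|<\epsilon$ for all $\gamma\in F$ and $i,j<k$.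 *)

(* Defs.v *)
From HB Require Import structures.
From mathcomp Require Import all_boot all_order all_algebra.
From mathcomp Require Import all_classical all_reals all_analysis.

Set Implicit Arguments.
Unset Strict Implicit.
Unset Printing Implicit Defensive.

Import Order.TTheory GRing.Theory Num.Theory.
Import numFieldNormedType.Exports.

Local Open Scope classical_set_scope.
Local Open Scope ring_scope.
Local Open Scope ereal_scope.

(* Completeness is expressed with Cauchy filters, as in the library's
   [completeType], which cannot be joined with [metricType] directly. *)
Definition polish (R : realType) (M : metricType R) : Prop :=
  (forall F : set_system M, ProperFilter F -> cauchy F ->
     exists x : M, F --> x) /\
  (exists2 D : set M, countable D & dense D).

(* The measurable sets of [T] are the Borel sets of a Polish topology on [T];
   the topology is carried by [M] and transported along the bijection [f]. *)
Definition standard_borel (R : realType) d (T : measurableType d) : Prop :=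
  exists (M : metricType R) (f : T -> M),
    [/\ polish M, bijective f &
        forall A : set T, measurable A <-> <<s @open M >> (f @` A)].

(* Since the group is countable and discrete, the action map from
   [G * X] to [X] is Borel iff each [a g] is. *)
Record mp_action (R : realType) (G : groupType) d (X : measurableType d)
    (a : G -> X -> X) (mu : probability X R) : Prop := MpAction {
  mp_standard_borel : standard_borel R X ;
  mp_act1 : forall x, a 1%g x = x ;
  mp_actM : forall g h x, a (g * h)%g x = a g (a h x) ;
  mp_measurable : forall g, measurable_fun setT (a g) ;
  mp_preserving : forall g (A : set X), measurable A ->
    mu (a g @^-1` A) = mu A }.

Definition ergodic (R : realType) (G : groupType) d (X : measurableType d)
    (a : G -> X -> X) (mu : probability X R) : Prop :=
  forall A : set X, measurable A -> (forall g, a g @^-1` A = A) ->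
    mu A = 0 \/ mu A = 1.

Definition identity_action (G : groupType) (Z : Type) : G -> Z -> Z :=
  fun _ z => z.

Record factor_map (R : realType) (G : groupType)
    d (Y : measurableType d) (b : G -> Y -> Y) (nu : probability Y R)
    d' (Z : measurableType d') (c : G -> Z -> Z) (eta : probability Z R)
    (pi : Y -> Z) : Prop := FactorMap {
  factor_measurable : measurable_fun setT pi ;
  factor_pushforward : forall C : set Z, measurable C ->
    pushforward nu pi C = eta C ;
  factor_equivariant : forall g, {ae nu, forall y, pi (b g y) = c g (pi y)} }.

(* [pprobability Y R] is the space of probability measures on [Y] with the
   sigma-algebra generated by the evaluations at measurable sets. *)
Record disintegration (R : realType)
    d (Y : measurableType d) (nu : probability Y R)
    d' (Z : measurableType d') (eta : probability Z R)
    (pi : Y -> Z) (nuz : Z -> pprobability Y R) : Prop := Disintegration {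
  disintegration_measurable : measurable_fun setT nuz ;
  disintegration_integral : forall B : set Y, measurable B ->
    nu B = \int[eta]_z nuz z B ;
  disintegration_fiber : {ae eta, forall z, nuz z (pi @^-1` [set z]) = 1} }.

(* Unlike in [classical_sets.partition], pieces may be empty. *)
Definition borel_partition d (X : measurableType d) (k : nat)
    (A : 'I_k -> set X) : Prop :=
  [/\ forall i, measurable (A i), trivIset setT A & \bigcup_i A i = setT].

Definition weakly_contained (R : realType) (G : groupType)
    d (X : measurableType d) (a : G -> X -> X) (mu : probability X R)
    d' (Y : measurableType d') (b : G -> Y -> Y) (nu : probability Y R) :
    Prop :=
  forall (k : nat) (A : 'I_k -> set X), borel_partition A ->
  forall F : set G, finite_set F -> forall eps : R, (0 < eps)%R ->
  exists2 B : 'I_k -> set Y, borel_partition B &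
    forall g, F g -> forall i j : 'I_k,
      `| mu ((a g @` A i) `&` A j) - nu ((b g @` B i) `&` B j) | < eps%:E.

(* Main.v *)
(* Weak containment of [a] in [d] provides finite-valued maps [psi n] on [Y]
   whose joint laws under [nu] approximate those of a given map on [X].  By the
   mean ergodic theorem on [X], convex combinations of translates of the
   indicator of an event are close in [L^2] to a constant; this is a condition
   on correlations, so it passes to [psi n] under [nu].  Averaging over the
   fibers, on which the translates all have the same measure, bounds the
   variance of [z |-> nuz z B] for the events [B] determined by [psi n].
   Hence the fiber laws of [psi n] concentrate in probability around the law on
   [X], and each given requirement of weak containment fails for a null set of
   [z]. *)

Require Import Defs.
From HB Require Import structures.
From mathcomp Require Import all_boot all_order all_algebra.
From mathcomp Require Import all_classical all_reals all_analysis.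
From mathcomp Require Import measurable_realfun ring lra.

Set Implicit Arguments.
Unset Strict Implicit.
Unset Printing Implicit Defensive.

Import Order.TTheory GRing.Theory Num.Theory.
Import numFieldNormedType.Exports.

Local Open Scope classical_set_scope.
Local Open Scope ring_scope.

(** Concentration of laws is not yet weak containment, which asks for a single partition of [Y]
    together with its translates under [d]. The map copied from [X] therefore records at once the
    piece containing [x] and the pieces containing finitely many translates of [x]. Nothing forces
    the coordinates of its copy [psi n] to be translates of one another. The event that they are not
    is, however, determined by joint laws and is empty on [X]. Its [nu]-measure thus tends to zero,
    and by Markov's inequality most fibers give it small measure. One coordinate of [psi n] then
    serves as the partition. The group elements of the convex combination are unrelated to those of
    the given requirement: they come from the mean ergodic theorem on [X], and weak containment
    accommodates them because they are finitely many. The partitions of [X] are uncountably many,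
    but a requirement sees a partition only through finitely many numbers, so countably many null
    sets suffice. *)

Lemma countable_enum (T : Type) (x0 : T) : countable [set: T] ->
  exists e : nat -> T, forall x, exists n, e n = x.
Proof.
move=> /pcard_injP[f finj].
exists (fun n =>
  if pselect (exists x, f x = n) is left h then projT1 (cid h) else x0).
move=> x; exists (f x); case: pselect => [h|[]]; last by exists x.
by apply: finj; rewrite ?inE// (projT2 (cid h)).
Qed.

(** * Integrals of bounded functions against a probability measure *)

Section bounded_functions.
Context d (T : measurableType d) (R : realType) (P : probability T R).
Implicit Types f g u : T -> R.

Lemma integrable_bounded f (M : R) : measurable_fun setT f ->
  (forall x, `|f x| <= M) -> P.-integrable setT (EFin \o f).
Proof.
move=> mf fM; apply: measurable_bounded_integrable => //.
  by rewrite [X in (X < _)%E](_ : _ = 1%E) ?ltry//; exact: probability_setT.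
exists M; split; first exact: num_real.
by move=> N MN x _ /=; rewrite (le_trans (fM x))// ltW.
Qed.

Lemma Rintegral_indic (A : set T) : measurable A ->
  \int[P]_x (\1_A x) = fine (P A).
Proof. by move=> mA; rewrite /Rintegral integral_indic// setIT. Qed.

Lemma Rintegral_prob_cst (r : R) : \int[P]_x r = r.
Proof.
rewrite Rintegral_cst// [X in fine X](_ : _ = 1%E) ?mulr1//.
exact: probability_setT.
Qed.

Lemma cvgn_series_fin (u : nat -> R) : (forall n, 0 <= u n) ->
  (\sum_(n <oo) (u n)%:E < +oo)%E -> cvgn (series u).
Proof.
move=> u0 uoo; have u0' n : (0 <= (u n)%:E)%E by rewrite lee_fin.
have s0 : (0 <= \sum_(n <oo) (u n)%:E)%E by apply: nneseries_ge0.
apply: nondecreasing_is_cvgn.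
  by apply/nondecreasing_series => n _.
exists (fine (\sum_(n <oo) (u n)%:E)) => _ [n _ <-].
rewrite -lee_fin fineK ?ge0_fin_numE// /series/= -sumEFin.
by apply: nneseries_lim_ge.
Qed.

(* [|u| <= (2^n u^2 + 2^-n) / 2], so the [L^1] norms are summable. *)
Lemma ae_cvg_series (u : nat -> T -> R) (M C : R) :
  (forall n, measurable_fun setT (u n)) -> (forall n x, `|u n x| <= M) ->
  (forall n, \int[P]_x (u n x ^+ 2) <= C * (2^-1 ^+ n) ^+ 2) ->
  {ae P, forall x, cvgn (series (fun n => `|u n x|))}.
Proof.
move=> mu uM uC.
have uM2 n x : u n x ^+ 2 <= M ^+ 2.
  rewrite -(real_normK (num_real (u n x))) ler_pXn2r ?nnegrE//.
  by rewrite (le_trans _ (uM n x)).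
have iu n : P.-integrable setT (EFin \o (fun x => `|u n x|)).
  apply: (@integrable_bounded _ M) => [|x]; last by rewrite normr_id.
  exact: measurableT_comp.
have iu2 n : P.-integrable setT (EFin \o (fun x => u n x ^+ 2)).
  apply: (@integrable_bounded _ (M ^+ 2)) => [|x].
    by apply: measurable_funX.
  by rewrite ger0_norm ?sqr_ge0.
pose K : R := (C + 1) / 2.
have L1 n : \int[P]_x `|u n x| <= K * 2^-1 ^+ n.
  have p0 : (0 : R) < 2^-1 ^+ n by rewrite exprn_gt0.
  have ib : P.-integrable setT
      (EFin \o (fun x => (2 * 2^-1 ^+ n)^-1 * u n x ^+ 2 + 2^-1 * 2^-1 ^+ n)).
    apply: integrable_bounded (_ : forall x, _ <=
      (2 * 2^-1 ^+ n)^-1 * M ^+ 2 + 2^-1 * 2^-1 ^+ n) => [|x].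
      apply: measurable_funD => //; apply: measurable_funM => //.
      exact: measurable_funX.
    rewrite ger0_norm.
      by rewrite lerD2r ler_pM2l ?invr_gt0 ?mulr_gt0.
    apply: addr_ge0; apply: mulr_ge0; rewrite ?sqr_ge0 ?(ltW p0) ?invr_ge0//.
  apply: (@le_trans _ _ (\int[P]_x
    ((2 * 2^-1 ^+ n)^-1 * u n x ^+ 2 + 2^-1 * 2^-1 ^+ n))).
    apply: le_Rintegral => // x _.
    rewrite -[u n x ^+ 2]real_normK ?num_real//.
    move: (2^-1 ^+ n) p0 `|u n x| => p p0 v.
    rewrite -subr_ge0 (_ : _ - _ = (2 * p)^-1 * (v - p) ^+ 2).
      by rewrite mulr_ge0 ?sqr_ge0// invr_ge0 mulr_ge0// ltW.
    by field; rewrite gt_eqF.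
  rewrite RintegralD//; first last.
  - exact: (@integrable_bounded _ `|2^-1 * 2^-1 ^+ n|).
  - apply: (@integrable_bounded _ ((2 * 2^-1 ^+ n)^-1 * M ^+ 2)) => [|x].
      by apply: measurable_funM => //; exact: measurable_funX.
    rewrite normrM ger0_norm ?invr_ge0 ?mulr_ge0 ?(ltW p0)//.
    by rewrite ler_pM2l ?invr_gt0 ?mulr_gt0// ger0_norm ?sqr_ge0.
  rewrite RintegralZl// Rintegral_prob_cst.
  apply: (@le_trans _ _ ((2 * 2^-1 ^+ n)^-1 *
    (C * (2^-1 ^+ n) ^+ 2) + 2^-1 * 2^-1 ^+ n)).
    by rewrite lerD2r ler_pM2l ?invr_gt0 ?mulr_gt0.
  by rewrite /K le_eqVlt; apply/orP; left; apply/eqP; field; rewrite gt_eqF.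
have mau n : measurable_fun setT (fun x => (`|u n x|)%:E).
  by apply/measurable_EFinP; exact: measurableT_comp.
have fin : (\int[P]_x (\sum_(n <oo) (`|u n x|)%:E) < +oo)%E.
  rewrite integral_nneseries//.
  apply: (@le_lt_trans _ _ (\sum_(n <oo) (K * 2^-1 ^+ n)%:E)%E).
    apply: lee_nneseries => [n _ _|n _]; first exact: integral_ge0.
    rewrite -[leLHS]fineK; first by rewrite lee_fin; exact: L1.
    exact: (integrable_fin_num measurableT (iu n)).
  have gc : series (geometric K 2^-1) @ \oo --> K * (1 - 2^-1)^-1.
    by apply: cvg_geometric_series; rewrite ger0_norm ?invr_ge0// invf_lt1// ltr1n.
  rewrite (_ : (\sum_(n <oo) _)%E = (K * (1 - 2^-1)^-1)%:E) ?ltry//.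
  apply/cvg_lim => //; rewrite (_ : (fun n => _) = EFin \o series (geometric K 2^-1)).
    by apply: cvg_EFin => //; exact: nearW.
  by apply/funext => n /=; rewrite sumEFin.
have : P.-integrable setT (fun x => \sum_(n <oo) (`|u n x|)%:E)%E.
  apply/integrableP; split.
    by apply: ge0_emeasurable_sum => // n x _ _.
  under eq_integral do rewrite gee0_abs ?nneseries_ge0//.
  exact: fin.
move=> /integrable_ae => /(_ measurableT); apply: filterS => x /(_ Logic.I) xfin.
apply: cvgn_series_fin => //.
by rewrite -ge0_fin_numE//; apply: nneseries_ge0.
Qed.

Lemma Rintegral_bounded_cvg (u : nat -> T -> R) f (M : R) :
  (forall n, measurable_fun setT (u n)) -> (forall n x, `|u n x| <= M) ->
  measurable_fun setT f -> {ae P, forall x, u n x @[n --> \oo] --> f x} ->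
  P.-integrable setT (EFin \o f) /\
  \int[P]_x u n x @[n --> \oo] --> \int[P]_x f x.
Proof.
move=> mu uM mf uf.
have mE g : measurable_fun setT g -> measurable_fun setT (EFin \o g).
  by move=> mg; exact/measurable_EFinP.
have [] := @dominated_convergence _ _ _ P setT measurableT
  (fun n => EFin \o u n) (EFin \o f) (cst M%:E).
- by move=> n; exact: mE.
- exact: mE.
- by apply: filterS uf => x ufx _; apply: cvg_EFin => //; exact: nearW.
- exact: (@integrable_bounded (cst M) `|M|).
- by apply: aeW => x n _; rewrite /= lee_fin.
move=> iF _ uF; split=> //; apply: (fine_cvg (f := fun n => _)).
by rewrite fineK//; exact: (integrable_fin_num measurableT iF).
Qed.

(** The difference [c - f] is nonnegative almost everywhere and has integral zero. *)
Lemma ae_eq_cst_Rintegral f (c : R) : P.-integrable setT (EFin \o f) ->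
  {ae P, forall x, f x <= c} -> \int[P]_x f x = c -> {ae P, forall x, f x = c}.
Proof.
move=> intf fc If; have ic : P.-integrable setT (EFin \o cst c).
  exact: (@integrable_bounded (cst c) `|c|).
have icf : P.-integrable setT (EFin \o (fun x => c - f x)).
  exact: (integrableB measurableT ic intf).
have mcf := measurable_int _ icf.
have : (\int[P]_x `|(c - f x)%R%:E| = 0)%E.
  transitivity (\int[P]_x (c - f x)%R%:E)%E.
    apply: ae_eq_integral => //; first exact: measurableT_comp.
    by apply: filterS fc => x fxc _ /=; rewrite ger0_norm ?subr_ge0.
  rewrite -[LHS]fineK; last exact: (integrable_fin_num measurableT icf).
  have : \int[P]_x (c - f x) = 0 by rewrite RintegralB// Rintegral_prob_cst If subrr.
  by rewrite /Rintegral => ->.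
move/(ae_eq_integral_abs P measurableT mcf); apply: filterS => x /(_ Logic.I) /= [].
by move/eqP; rewrite subr_eq0 => /eqP.
Qed.

End bounded_functions.

(** * Mean ergodic theorem *)

(* Convex combinations with dyadic weights: closed under midpoints, which is all
   that the minimal norm argument needs. *)
Inductive dyadic (G : Type) : Type :=
  Leaf of G | Mid of dyadic G & dyadic G.

Fixpoint dmean (R : realType) (G : Type) (u : G -> R) (t : dyadic G) : R :=
  match t with
  | Leaf g => u g
  | Mid s s' => (dmean u s + dmean u s') / 2
  end.

Fixpoint dmap (G H : Type) (f : G -> H) (t : dyadic G) : dyadic H :=
  match t with
  | Leaf g => Leaf (f g)
  | Mid s s' => Mid (dmap f s) (dmap f s')
  end.

Section dyadic_means.
Variables (R : realType) (G : Type).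
Implicit Types (u : G -> R) (t s : dyadic G).

Lemma dmean_cst (c : R) t : dmean (fun=> c) t = c.
Proof.
by elim: t => //= s -> s' ->; rewrite -mulr2n -(mulr_natr c) mulfK// pnatr_eq0.
Qed.

Lemma dmeanZl (c : R) u t : dmean (fun g => c * u g) t = c * dmean u t.
Proof. by elim: t => //= s -> s' ->; rewrite -mulrDr mulrA. Qed.

Lemma dmean_map (H : Type) (f : H -> G) u (t : dyadic H) :
  dmean u (dmap f t) = dmean (u \o f) t.
Proof. by elim: t => //= s -> s' ->. Qed.

Lemma eq_dmean u v t : u =1 v -> dmean u t = dmean v t.
Proof. by move=> uv; congr dmean; apply/funext. Qed.

Lemma dmean_itv01 u t : (forall g, 0 <= u g <= 1) -> 0 <= dmean u t <= 1.
Proof.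
by move=> u01; elim: t => //= s /andP[? ?] s' /andP[? ?]; apply/andP; split; lra.
Qed.

Lemma normr_dmean_le (M : R) u t : (forall g, `|u g| <= M) -> `|dmean u t| <= M.
Proof.
move=> uM; elim: t => //= s IHs s' IHs'; move: IHs IHs'.
by rewrite !ler_norml => /andP[? ?] /andP[? ?]; apply/andP; split; lra.
Qed.

Lemma sqr_dmean u t :
  dmean u t ^+ 2 = dmean (fun g => dmean (fun h => u g * u h) t) t.
Proof.
rewrite expr2 -dmeanZl; apply: eq_dmean => g.
by rewrite mulrC -dmeanZl.
Qed.

Lemma cvg_dmean (u : nat -> G -> R) v t :
  (forall g, u n g @[n --> \oo] --> v g) ->
  dmean (u n) t @[n --> \oo] --> dmean v t.
Proof.
by move=> uv; elim: t => //= s IHs s' IHs'; apply: cvgMl; exact: cvgD.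
Qed.

End dyadic_means.

Section integral_dyadic_means.
Context (R : realType) (G : Type) d (T : measurableType d).
Variables (P : probability T R) (F : G -> T -> R).
Hypothesis mF : forall g, measurable_fun setT (F g).

Lemma measurable_dmean t : measurable_fun setT (fun x => dmean (F^~ x) t).
Proof.
elim: t => //= s IHs s' IHs'.
by apply: measurable_funM => //; exact: measurable_funD.
Qed.

Lemma Rintegral_dmean (M : R) t : (forall g x, `|F g x| <= M) ->
  \int[P]_x dmean (F^~ x) t = dmean (fun g => \int[P]_x F g x) t.
Proof.
move=> FM; have iF s : P.-integrable setT (EFin \o (fun x => dmean (F^~ x) s)).
  apply: (@integrable_bounded _ _ _ _ _ M); first exact: measurable_dmean.
  by move=> x; exact: normr_dmean_le.
elim: t => //= s <- s' <-.
by rewrite RintegralZr ?RintegralD//; exact: (integrableD measurableT (iF s) (iF s')).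
Qed.

End integral_dyadic_means.

(** This is the squared [L^2] norm of the [t]-average of translates of the indicator of [E],
    expanded into correlations. In this form it is linear in [P], so it integrates over fibers, and
    it only involves quantities that weak containment controls. *)
Definition autocorr (R : realType) (G X : Type) (a : G -> X -> X)
    (P : set X -> \bar R) (E : set X) (t : dyadic G) : R :=
  dmean (fun g => dmean (fun h =>
    fine (P (a g @^-1` E `&` a h @^-1` E))) t) t.

Section mean_ergodic.
Context (R : realType) (G : groupType) d (X : measurableType d).
Variables (a : G -> X -> X) (mu : probability X R).
Hypothesis mp_a : mp_action a mu.

Lemma mp_measurable_preimage g (A : set X) : measurable A ->
  measurable (a g @^-1` A).
Proof. by move=> mA; rewrite -[X in measurable X]setTI; exact: (mp_measurable mp_a). Qed.

Lemma Rintegral_mp g (f : X -> R) : measurable_fun setT f ->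
  (forall x, 0 <= f x) -> \int[mu]_x f (a g x) = \int[mu]_x f x.
Proof.
move=> mf f0; rewrite /Rintegral; congr fine.
transitivity (\int[pushforward mu (a g)]_x (f x)%:E)%E.
  rewrite ge0_integral_pushforward//; first exact: (mp_measurable mp_a).
  - exact/measurable_EFinP.
  - by move=> x _; rewrite lee_fin.
apply: eq_measure_integral => [|? A mA _]; first exact: (mp_measurable mp_a).
exact: (mp_preserving mp_a).
Qed.

(** Ergodicity is stated for strictly invariant sets. The intersection of all translates of [A] is
    strictly invariant, since the group permutes the translates, and by countability it differs from
    [A] by a null set. *)
Lemma ergodic_ae (e : nat -> G) (A : set X) : (forall g, exists n, e n = g) ->
  ergodic a mu -> measurable A -> (forall g, mu (A `\` a g @^-1` A) = 0%E) ->
  mu A = 0%E \/ mu A = 1%E.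
Proof.
move=> e_surj erg mA A0; have mg g := mp_measurable_preimage g mA.
pose B := \bigcap_n a (e n) @^-1` A.
have BA g x : B x -> A (a g x) by have [n <-] := e_surj g; exact.
have mB : measurable B by exact: bigcapT_measurable.
have BsA : B `<=` A by move=> x Bx; have := BA 1%g x Bx; rewrite (mp_act1 mp_a).
have -> : mu A = mu B.
  apply/eqP; rewrite eq_le; apply/andP; split; last first.
    by apply: le_measure => //; rewrite inE.
  rewrite -(setDKU BsA).
  rewrite (le_trans (measureU2 _ _ _))//; first exact: measurableD.
  rewrite [X in (X + _)%E](_ : _ = 0%E) ?add0e//.
  apply/negligibleP; first exact: measurableD.
  rewrite /B setDE setC_bigcap setI_bigcupr; apply: negligible_bigcup => n.
  by rewrite -setDE; apply/negligibleP; [exact: measurableD|exact: A0].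
apply: erg => // g; apply/seteqP; split => x Bx n _ /=.
  by have := BA (e n * g^-1)%g _ Bx; rewrite -(mp_actM mp_a) mulgVK.
by rewrite -(mp_actM mp_a); exact: BA.
Qed.


Section squared_norms.
Variables (E : set X) (mE : measurable E).

Definition orbit_mean (t : dyadic G) (x : X) : R :=
  dmean (fun g => \1_E (a g x)) t.
Local Notation f := orbit_mean.
Let q t : R := \int[mu]_x f t x ^+ 2.

Let f01 t x : 0 <= f t x <= 1.
Proof. by apply: dmean_itv01 => g; rewrite indicE ler0n lern1 leq_b1. Qed.

Lemma measurable_orbit_indic g : measurable_fun setT (fun x => \1_E (a g x) : R).
Proof.
apply: (@measurableT_comp _ _ _ _ _ _ (\1_E : X -> R) _ (a g)) => //.
exact: (mp_measurable mp_a).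
Qed.

Let mf t : measurable_fun setT (f t).
Proof. by apply: measurable_dmean => g; exact: measurable_orbit_indic. Qed.

Let fg_le1 t s x : `|f t x * f s x| <= 1.
Proof.
have /andP[? ?] := f01 t x; have /andP[? ?] := f01 s x.
by rewrite ger0_norm ?mulr_ge0// mulr_ile1.
Qed.

Let ifg t s : mu.-integrable setT (EFin \o (fun x => f t x * f s x)).
Proof.
by apply: (integrable_bounded mu _ (fg_le1 t s)); exact: measurable_funM.
Qed.

(** Right multiplication of the labels by [g] precomposes the orbit mean with [a g], which preserves
    [mu]. Hence a translate of a nearly minimal mean is again nearly minimal. *)
Let q_dmap t g : q (dmap (fun h => (h * g)%g) t) = q t.
Proof.
rewrite /q -(@Rintegral_mp g (fun x => f t x ^+ 2)); last 2 first.
- exact: measurable_funX.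
- by move=> x; exact: sqr_ge0.
apply: eq_Rintegral => x _; congr (_ ^+ 2).
by rewrite /f dmean_map; apply: eq_dmean => h /=; rewrite (mp_actM mp_a).
Qed.

(** The midpoint of two orbit means is the orbit mean of [Mid t s], so the parallelogram law
    involves values of [q] only. *)
Let parallelogram t s :
  \int[mu]_x ((f t x - f s x) ^+ 2) = 2 * q t + 2 * q s - 4 * q (Mid t s).
Proof.
have iX u : mu.-integrable setT (EFin \o (fun x => f u x ^+ 2)).
  by under eq_fun do rewrite /= expr2; exact: ifg.
have iZ (c : R) u : mu.-integrable setT (EFin \o (fun x => c * f u x ^+ 2)).
  exact: (integrableZl measurableT c (iX u)).
rewrite -!RintegralZl// -RintegralD// -RintegralB//; last first.
  exact: (integrableD measurableT (iZ 2 t) (iZ 2 s)).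
by apply: eq_Rintegral => x _; rewrite /f/=; field.
Qed.

Let mean_orbit_mean t : \int[mu]_x f t x = fine (mu E).
Proof.
rewrite (@Rintegral_dmean _ _ _ _ mu (fun g x => \1_E (a g x)) _ 1); last 2 first.
- exact: measurable_orbit_indic.
- by move=> g x; rewrite indicE ger0_norm// lern1 leq_b1.
rewrite -[RHS](dmean_cst _ t); apply: eq_dmean => g.
by rewrite Rintegral_mp// Rintegral_indic.
Qed.

(* The orbit averages of nearly minimal norm form an almost invariant
   Cauchy sequence; its limit is invariant, hence constant. *)
Lemma mean_ergodic (e : nat -> G) (eps : R) : (forall g, exists n, e n = g) ->
  ergodic a mu -> 0 < eps ->
  exists t, \int[mu]_x (orbit_mean t x ^+ 2) < fine (mu E) ^+ 2 + eps.
Proof.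
move=> e_surj erg eps0.
have q0 t : 0 <= q t by apply: Rintegral_ge0 => x _; exact: sqr_ge0.
have hq : has_inf (range q).
  by split; [exists (q (Leaf 1%g)), (Leaf 1%g)|exists 0 => _ [t _ <-]].
have qm t : inf (range q) <= q t by apply: ge_inf => //; case: hq.
(* The square makes the [L^2] distances of order [2^-n], hence summable, as [ae_cvg_series]
   requires. *)
pose delta n : R := (2^-1 ^+ n) ^+ 2.
have delta0 n : 0 < delta n by rewrite !exprn_gt0.
have /choice[t tq] n : exists t, q t < inf (range q) + delta n.
  by have [_ [t _ <-] ?] := inf_adherent (delta0 n) hq; exists t.
(* The midpoint has [q] at least the infimum, so any two nearly minimal means are close. This is
   used twice: against translates of [t n] it gives invariance of the limit, against [t n.+1] it
   gives convergence. *)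
have dist s n : q s <= inf (range q) + delta n ->
    \int[mu]_x ((f (t n) x - f s x) ^+ 2) <= 4 * delta n.
  move=> sq; rewrite parallelogram; have := qm (Mid (t n) s).
  have := tq n; move: sq.
  by move: (q s) (q (t n)) (q (Mid _ _)) (delta n) (inf _) => *; lra.
have series_cvg (s : nat -> dyadic G) : (forall n, q (s n) <= inf (range q) + delta n) ->
    {ae mu, forall x, cvgn (series (fun n => `|f (t n) x - f (s n) x|))}.
  move=> sq; apply: (@ae_cvg_series _ _ _ mu _ 1 4) => [n|n x|n].
  - exact: measurable_funB.
  - have /andP[? ?] := f01 (t n) x; have /andP[? ?] := f01 (s n) x.
    by rewrite ler_norml; apply/andP; split; lra.
  - exact: dist.
have inv_ae g : {ae mu, forall x, f (t n) x - f (t n) (a g x) @[n --> \oo] --> (0 : R)}.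
  have := series_cvg (fun n => dmap (fun h => (h * g)%g) (t n)).
  move=> /(_ _)/wrap[]; first by move=> n; rewrite q_dmap ltW.
  apply: filterS => x /cvg_series_cvg_0 /norm_cvg0P.
  by apply: cvg_trans; apply: near_eq_cvg; near=> n; rewrite /f dmean_map;
    congr (_ - _); apply: eq_dmean => h /=; rewrite (mp_actM mp_a).
have cvg_ae : {ae mu, forall x, cvgn (fun n => f (t n) x)}.
  have := series_cvg (fun n => t n.+1).
  move=> /(_ _)/wrap[].
    move=> n; rewrite (le_trans (ltW (tq n.+1)))// lerD2l /delta.
    rewrite ler_pXn2r ?nnegrE ?exprn_ge0// exprSr ler_piMr ?exprn_ge0//.
    by rewrite invf_le1// ler1n.
  apply: filterS => x /normed_cvg scvg.
  rewrite (_ : (fun n => _) = (fun n =>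
    f (t 0) x - series (fun n => f (t n) x - f (t n.+1) x) n)).
    by apply: is_cvgB => //; exact: is_cvg_cst.
  apply/funext => n; rewrite /series/= -[X in _ - X]opprK -sumrN.
  under eq_bigr do rewrite opprB.
  by rewrite telescope_sumr// opprK addrC subrK.
(* The limit superior is defined and measurable everywhere, and it is the limit wherever the latter
   exists. *)
pose F x := fine (limn_esup (fun n => (f (t n) x)%:E)).
have FE x l : f (t n) x @[n --> \oo] --> l -> F x = l.
  move=> fl; have fl' : (f (t n) x)%:E @[n --> \oo] --> l%:E.
    by apply: cvg_EFin => //; exact: nearW.
  by rewrite /F is_cvg_limn_esupE; [rewrite (cvg_lim _ fl')|apply/cvg_ex; exists l%:E].
have mF : measurable_fun setT F.
  apply: measurableT_comp => //; apply: measurable_fun_limn_esup => n.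
  exact/measurable_EFinP.
have F_cvg : {ae mu, forall x, f (t n) x @[n --> \oo] --> F x}.
  by apply: filterS cvg_ae => x /cvg_ex[l fl]; rewrite (FE _ _ fl).
have F_inv g : {ae mu, forall x, F (a g x) = F x}.
  apply: filterS2 (inv_ae g) F_cvg => x inv fF; apply: FE.
  rewrite -[F x]subr0 (_ : (fun n => _) =
    (fun n => f (t n) x - (f (t n) x - f (t n) (a g x)))); first exact: cvgB.
  by apply/funext => n; rewrite opprB addrC subrK.
have f_le1 s x : `|f s x| <= 1.
  by have /andP[? ?] := f01 s x; rewrite ger0_norm.
have [iF meanF] := Rintegral_bounded_cvg (fun n => mf (t n))
  (fun n x => f_le1 (t n) x) mF F_cvg.
have IF : \int[mu]_x F x = fine (mu E).
  apply/esym/(cvg_unique _ _ meanF) => //.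
  rewrite /= (_ : (fun n => _) = cst (fine (mu E))); first exact: cvg_cst.
  by apply/funext => n; rewrite mean_orbit_mean.
(* A single level set is enough, the one at the mean [c]: being null or conull, it gives [F >= c] or
   [F <= c] almost everywhere, and a function on one side of its mean equals it. *)
have F_cst : {ae mu, forall x, F x = fine (mu E)}.
  set c := fine (mu E) in IF *.
  have mA : measurable [set x | F x <= c].
    rewrite (_ : mkset _ = setT `&` F @^-1` `]-oo, c]); first exact: mF.
    by rewrite setTI; apply/seteqP; split => x /=; rewrite in_itv.
  have [g||] := ergodic_ae e_surj erg mA.
  - apply/negligibleP.
      by apply: measurableD => //; exact: mp_measurable_preimage.
    apply: negligibleS (F_inv g) => x [/= Fx Fgx] FE'.
    by apply: Fgx; rewrite FE'.
  - move/negligibleP => /(_ mA) A0.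
    have : {ae mu, forall x, - F x = - c}.
      apply: ae_eq_cst_Rintegral.
      + exact: (integrableN iF).
      + by apply: negligibleS A0 => x /= /negP; rewrite lerN2 -ltNge => /ltW.
      + under eq_Rintegral do rewrite -mulN1r.
        by rewrite RintegralZl// IF mulN1r.
    by apply: filterS => x /oppr_inj.
  - move=> A1; apply: ae_eq_cst_Rintegral => //.
    apply/negligibleP; first exact: measurableC.
    by have := probability_setC mu mA; rewrite A1 subee.
have normF : q (t n) @[n --> \oo] --> fine (mu E) ^+ 2.
  rewrite -(Rintegral_prob_cst mu (fine (mu E) ^+ 2)).
  have [] := @Rintegral_bounded_cvg _ _ _ mu (fun n x => f (t n) x ^+ 2)
    (cst (fine (mu E) ^+ 2)) 1; last by [].
  - by move=> n; exact: measurable_funX.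
  - by move=> n x; rewrite expr2; exact: fg_le1.
  - exact: measurable_cst.
  - apply: filterS2 F_cvg F_cst => x fF Fx; rewrite /= -Fx expr2.
    by under eq_fun do rewrite expr2; exact: cvgM.
have : \forall n \near \oo, q (t n) < fine (mu E) ^+ 2 + eps.
  by move/cvgr_lt: normF; apply; rewrite ltrDl.
by move=> [n _ /(_ n (leqnn n))] ?; exists (t n).
Unshelve. all: by end_near. Qed.

Lemma Rintegral_sqr_orbit_mean t :
  \int[mu]_x (orbit_mean t x ^+ 2) = autocorr a mu E t.
Proof.
have mI g := measurable_orbit_indic g.
have I_le1 g x : `|\1_E (a g x) : R| <= 1 by rewrite indicE ger0_norm// lern1 leq_b1.
have II_le1 g h x : `|\1_E (a g x) * \1_E (a h x) : R| <= 1.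
  by rewrite normrM mulr_ile1.
rewrite /orbit_mean; under eq_Rintegral do rewrite sqr_dmean.
rewrite (@Rintegral_dmean _ _ _ _ mu
  (fun g x => dmean (fun h => \1_E (a g x) * \1_E (a h x)) t) _ 1); last 2 first.
- by move=> g; apply: measurable_dmean => h; exact: measurable_funM.
- by move=> g x; exact: normr_dmean_le.
apply: eq_dmean => g.
rewrite (@Rintegral_dmean _ _ _ _ mu
  (fun h x => \1_E (a g x) * \1_E (a h x)) _ 1)//; last first.
  by move=> h; exact: measurable_funM.
apply: eq_dmean => h; rewrite -Rintegral_indic; last first.
  by apply: measurableI; exact: mp_measurable_preimage.
by apply: eq_Rintegral => x _; rewrite indicI.
Qed.

(** The difference of the two sides is the variance of the orbit mean, whose integral is [mu E]. It
    will be applied to the fiber measures. *)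
Lemma sqr_le_autocorr t : fine (mu E) ^+ 2 <= autocorr a mu E t.
Proof.
rewrite -Rintegral_sqr_orbit_mean -subr_ge0.
have if1 : mu.-integrable setT (EFin \o f t).
  apply: (@integrable_bounded _ _ _ mu _ 1) => // x.
  by have /andP[? ?] := f01 t x; rewrite ger0_norm.
pose c := fine (mu E).
have ic : mu.-integrable setT (EFin \o cst (c ^+ 2)).
  exact: (@integrable_bounded _ _ _ mu (cst (c ^+ 2)) `|c ^+ 2|).
have i2 : mu.-integrable setT (EFin \o (fun x => f t x ^+ 2)).
  by under eq_fun do rewrite /= expr2; exact: ifg.
have iZ : mu.-integrable setT (EFin \o (fun x => 2 * c * f t x)).
  exact: (integrableZl measurableT (2 * c) if1).
suff <- : \int[mu]_x ((f t x - c) ^+ 2) = \int[mu]_x (f t x ^+ 2) - c ^+ 2.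
  by apply: Rintegral_ge0 => x _; exact: sqr_ge0.
transitivity (\int[mu]_x (f t x ^+ 2 - 2 * c * f t x + c ^+ 2)).
  by apply: eq_Rintegral => x _; ring.
rewrite RintegralD//; last exact: (integrableB measurableT i2 iZ).
rewrite RintegralB// RintegralZl// mean_orbit_mean Rintegral_prob_cst -/c.
ring.
Qed.

End squared_norms.

End mean_ergodic.

(** * Disintegration over an identity factor *)

Lemma standard_borel_set1 (R : realType) d (T : measurableType d) (x : T) :
  standard_borel R T -> measurable [set x].
Proof.
move=> [M [f [_ _ ->]]]; rewrite image_set1.
rewrite -[X in _ X]setCK -setTD; apply: sigma_algebraCD.
apply: sub_sigma_algebra => /=; rewrite openC.
exact/accessible_closed_set1/hausdorff_accessible/metric_hausdorff.
Qed.

Lemma polish_countable_base (R : realType) (M : metricType R) : polish M ->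
  exists U : nat -> set M, [/\ forall n, open (U n) &
    forall O : set M, open O -> O = \bigcup_(n in [set n | U n `<=` O]) U n].
Proof.
move=> [_ [D /pcard_injP[h hinj] Ddense]].
(* Since [h] is injective on [D], the number [m.1] names at most one centre; [m.2] gives the
   radius. *)
pose V (m : nat * nat) : set M :=
  interior [set y | exists2 x, D x & h x = m.1 /\ ball x m.2.+1%:R^-1 y].
exists (fun n => if unpickle n is Some m then V m else set0); split.
  by move=> n; case: unpickle => [m|]; [exact: open_interior|exact: open0].
move=> O oO; apply/seteqP; split => [y Oy|y [n /= nO]]; last exact: nO.
have /nbhs_ballP[eps /= eps0 epsO] := open_nbhs_nbhs (conj oO Oy).
have eps20 : 0 < eps / 2 by rewrite divr_gt0.
have [k _ /(_ k (leqnn k)) /= keps] := near_infty_natSinv_lt (PosNum eps20).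
have k0 : (0 : R) < k.+1%:R^-1 by rewrite invr_gt0.
have ke : k.+1%:R^-1 + k.+1%:R^-1 <= eps by rewrite [leRHS]splitr lerD// ltW.
(* With a centre within half the radius of [y], the ball contains a neighbourhood of [y], so [y]
   survives passing to the interior. *)
pose r : R := k.+1%:R^-1 / 2.
have r0 : 0 < r by rewrite divr_gt0.
have [x [/interior_subset xy Dx]] : (interior (ball y r) `&` D) !=set0.
  apply: Ddense; last exact: open_interior.
  by exists y; apply: nbhsx_ballx.
exists (pickle (h x, k)); rewrite /= pickleK.
  move=> w /interior_subset[x' Dx' [/= hx' x'w]].
  have xx' : x' = x by apply: hinj; rewrite ?inE.
  rewrite xx' in x'w; apply: epsO; apply: le_ball ke _ _.
  apply: ball_triangle x'w; apply: le_ball xy.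
  by rewrite /r ler_pdivrMr// mulr_natr mulr2n lerDl ltW.
rewrite /V/=; apply: filterS (nbhsx_ballx y r r0) => w yw; exists x => //; split => //.
rewrite [X in ball x X](splitr k.+1%:R^-1).
by apply: ball_triangle yw; exact: ball_sym.
Qed.

(** A countable base, pulled back along the bijection and closed under finite intersections, is a
    countable generating pi-system. Equality of two probability measures thus reduces to countably
    many equations, each of which may fail on its own null set. *)
Lemma standard_borel_pi_system (R : realType) d (T : measurableType d) :
  standard_borel R T -> exists U : nat -> set T,
  measurable = <<s [set \big[setI/setT]_(i <- s) U i | s in [set: seq nat]] >>.
Proof.
move=> [M [f [/polish_countable_base[U [oU Ubase]] [f' fK f'K] fmeas]]].
exists (fun n => f @^-1` U n).
set G := (X in <<s X>>).
have fmeas' A : <<s @open M >> A -> measurable (f @^-1` A).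
  move=> A_; apply/fmeas; rewrite image_preimage//.
  by apply/seteqP; split => // y _; exists (f' y).
apply/seteqP; split => A; last first.
  apply: smallest_sub; first exact: sigma_algebra_measurable.
  move=> _ [s _ <-]; apply: bigsetI_measurable => i _.
  by apply: fmeas'; apply: sub_sigma_algebra.
move=> /fmeas fA; rewrite (_ : A = f @^-1` (f @` A)); last first.
  apply/seteqP; split => [x Ax|x [y Ay /(can_inj fK) <-]//]; by exists x.
move: (f @` A) fA => {}A.
have : <<s @open M >> `<=` [set B | <<s G >> (f @^-1` B)]; last exact.
apply: smallest_sub.
  split => /=.
  - by rewrite preimage_set0; exact: sigma_algebra0.
  - by move=> B sB; rewrite setTD preimage_setC -setTD; exact: sigma_algebraCD.
  - by move=> B sB; rewrite preimage_bigcup; exact: sigma_algebra_bigcup.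
move=> O oO; rewrite /= (Ubase _ oO) preimage_bigcup.
rewrite bigcup_mkcond; apply: sigma_algebra_bigcup => n.
case: ifP => _; last exact: sigma_algebra0.
by apply: sub_sigma_algebra; exists [:: n] => //; rewrite big_seq1.
Qed.

Section disintegration_invariance.
Context (R : realType) (G : groupType).
Context (dY : measure_display) (Y : measurableType dY).
Variables (d : G -> Y -> Y) (nu : probability Y R).
Context (dZ : measure_display) (Z : measurableType dZ).
Variables (eta : probability Z R) (pi : Y -> Z) (nuz : Z -> pprobability Y R).
Hypotheses (mp_d : mp_action d nu) (borelZ : standard_borel R Z).
Hypothesis factor_pi : factor_map d nu (@identity_action G Z) eta pi.
Hypothesis disint : disintegration nu eta pi nuz.
Implicit Types (B : set Y) (C : set Z).

Lemma measurable_disintegration B : measurable B ->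
  measurable_fun setT (fun z => nuz z B).
Proof. exact: (measurable_kernel (kprobability (disintegration_measurable disint))). Qed.

Lemma prob_eq_on (P : probability Y R) F A B : measurable F -> measurable A ->
  measurable B -> P F = 1%E -> A `&` F = B `&` F -> P A = P B.
Proof.
move=> mF mA mB PF AB.
have PC : P (~` F) = 0%E by rewrite probability_setC// PF subee.
have aux D : measurable D -> P D = P (D `&` F).
  move=> mD; apply/eqP; rewrite eq_le; apply/andP; split; last first.
    by apply: le_measure; rewrite ?inE//; exact: measurableI.
  rewrite -{1}(setUIDK D F) (le_trans (measureU2 _ _ _))//.
  - exact: measurableI.
  - exact: measurableD.
  rewrite -[leRHS]adde0 leeD2l// -PC le_measure ?inE//.
  - exact: measurableD.
  - exact: measurableC.
by rewrite aux// AB -aux.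
Qed.

Let mpi C : measurable C -> measurable (pi @^-1` C).
Proof.
move=> mC; rewrite -[X in measurable X]setTI.
exact: (factor_measurable factor_pi).
Qed.

Lemma disintegration_restrict B C : measurable B -> measurable C ->
  (\int[eta]_(z in C) nuz z B = nu (B `&` pi @^-1` C))%E.
Proof.
move=> mB mC; have mBC : measurable (B `&` pi @^-1` C).
  by apply: measurableI => //; exact: mpi.
rewrite (disintegration_integral disint)// integral_mkcond.
apply: ae_eq_integral => //.
- apply/(measurable_restrictT _ mC)/measurable_funTS.
  exact: measurable_disintegration.
- exact: measurable_disintegration.
apply: filterS (disintegration_fiber disint) => z fz _.
rewrite patchE; case: ifPn => [/set_mem Cz|/negP Cz].
  apply: (prob_eq_on (mpi (standard_borel_set1 z borelZ))) => //.
  by rewrite -setIA; congr setI; rewrite setIidr// => y /= ->.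
transitivity (nuz z set0); first by rewrite measure0.
apply: (prob_eq_on (mpi (standard_borel_set1 z borelZ))) => //.
apply/seteqP; split => y [] // [_ /= Cy] yz.
by case: Cz; apply/mem_set; rewrite -yz.
Qed.

Let md g B : measurable B -> measurable (d g @^-1` B).
Proof. exact: (mp_measurable_preimage mp_d). Qed.

Lemma disintegration_ae_invariant_set g B : measurable B ->
  {ae eta, forall z, nuz z (d g @^-1` B) = nuz z B}.
Proof.
move=> mB; have mgB := md g mB.
have : ae_eq eta setT (fun z => nuz z (d g @^-1` B)) (fun z => nuz z B).
  apply: integral_ae_eq => //.
  - apply/integrableP; split; first exact: measurable_disintegration.
    apply: (@le_lt_trans _ _ (\int[eta]_z cst 1%E z)%E).
      apply: ge0_le_integral => //.
      + by apply: measurableT_comp => //; exact: measurable_disintegration.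
      + by move=> z _; rewrite gee0_abs// probability_le1.
    by rewrite integral_cst// mul1e; apply: fin_num_fun_lty.
  - exact: measurable_disintegration.
  move=> C _ mC; rewrite !disintegration_restrict//.
  rewrite -[RHS](mp_preserving mp_d g); last by apply: measurableI => //; exact: mpi.
  have [N [mN N0 piN]] := factor_equivariant factor_pi g.
  have NC1 : nu (~` N) = 1%E by rewrite probability_setC// N0 sube0.
  apply: (prob_eq_on (measurableC mN)) => //.
  - by apply: measurableI => //; exact: mpi.
  - by apply: md; apply: measurableI => //; exact: mpi.
  have key y : (~` N) y -> pi (d g y) = pi y.
    by move=> Ny; apply: contrapT => h; apply: Ny; exact: piN.
  by apply/seteqP; split => y [[By Cy] Ny]; split=> //; split=> //=;
    move: Cy; rewrite /= (key _ Ny).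
by apply: filterS => z; apply.
Qed.

(** The null set must be chosen before [B]. Invariance on the countable pi-system holds off one null
    set and extends to all measurable sets by uniqueness of measures. *)
Lemma disintegration_ae_invariant g :
  {ae eta, forall z B, measurable B -> nuz z (d g @^-1` B) = nuz z B}.
Proof.
have [U YU] := standard_borel_pi_system (mp_standard_borel mp_d).
pose V (s : seq nat) := \big[setI/setT]_(i <- s) U i.
have mV s : measurable (V s).
  by rewrite YU; apply: sub_sigma_algebra; exists s.
have : {ae eta, forall z, forall n,
    (* A number that codes no sequence stands for [V [::]], the whole space, where the equation is
       harmless. *)
    nuz z (d g @^-1` V (odflt [::] (unpickle n))) =
    nuz z (V (odflt [::] (unpickle n)))}.
  by apply: ae_foralln => n; exact: disintegration_ae_invariant_set.
apply: filterS => z inv B mB.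
apply: (@measure_unique _ _ _ _ (fun=> setT) YU _ _ _
  (pushforward (nuz z) (d g)) (nuz z)) => //.
- by move=> _ _ [s _ <-] [t _ <-]; exists (s ++ t) => //; rewrite big_cat.
- by move=> _; exists [::] => //; rewrite big_nil.
- by rewrite bigcup_const//; exists 0%N.
- exact: (mp_measurable mp_d).
- by move=> ? _ [s _ <-]; have := inv (pickle s); rewrite pickleK.
- by move=> ? _; rewrite /= /pushforward; apply: fin_num_fun_lty.
Qed.

Lemma disintegration_ae_mp_action (e : nat -> G) :
  (forall g, exists n, e n = g) -> {ae eta, forall z, mp_action d (nuz z)}.
Proof.
move=> e_surj.
have : {ae eta, forall z n B, measurable B -> nuz z (d (e n) @^-1` B) = nuz z B}.
  by apply: ae_foralln => n; exact: disintegration_ae_invariant.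
apply: filterS => z inv; case: mp_d => *; split => // g A mA.
by have [n <-] := e_surj g; exact: inv.
Qed.

Local Notation p B z := (fine (nuz z B)).

Lemma measurable_fine_disintegration B : measurable B ->
  measurable_fun setT (fun z => fine (nuz z B)).
Proof.
by move=> mB; apply: measurableT_comp => //; exact: measurable_disintegration.
Qed.

Lemma fine_prob_itv01 (P : probability Y R) B :
  measurable B -> 0 <= fine (P B) <= 1.
Proof.
move=> mB; rewrite fine_ge0//= -lee_fin fineK ?probability_le1//.
exact: fin_num_measure.
Qed.

Let p_le1 B z : measurable B -> `|p B z| <= 1.
Proof. by move=> mB; have /andP[? ?] := fine_prob_itv01 (nuz z) mB; rewrite ger0_norm. Qed.

Lemma Rintegral_disintegration B : measurable B ->
  \int[eta]_z fine (nuz z B) = fine (nu B).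
Proof.
move=> mB; rewrite (disintegration_integral disint)// /Rintegral; congr fine.
by apply: eq_integral => z _; rewrite fineK//; exact: fin_num_measure.
Qed.

(** Since [autocorr] is linear in the measure, its value at [nu] is the integral of its values at
    the fibers, and each of these is at least [nuz z B ^+ 2]. The integral of [nuz z B] is [nu B],
    so subtracting [nu B ^+ 2] leaves the variance. *)
Lemma variance_disintegration B (t : dyadic G) :
  {ae eta, forall z, mp_action d (nuz z)} -> measurable B ->
  \int[eta]_z ((fine (nuz z B) - fine (nu B)) ^+ 2) <=
  autocorr d nu B t - fine (nu B) ^+ 2.
Proof.
move=> ae_mp mB; set c := fine (nu B).
have mI g h : measurable (d g @^-1` B `&` d h @^-1` B).
  by apply: measurableI; exact: md.
pose q z := autocorr d (nuz z) B t.
have q_le1 z : `|q z| <= 1.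
  by do 2 apply: normr_dmean_le => ?; exact: p_le1.
have mq : measurable_fun setT q.
  by do 2 apply: measurable_dmean => ?; exact: measurable_fine_disintegration.
have <- : \int[eta]_z q z = autocorr d nu B t.
  rewrite (@Rintegral_dmean _ _ _ _ eta
    (fun g z => dmean (fun h => p (d g @^-1` B `&` d h @^-1` B) z) t) _ 1).
  - apply: eq_dmean => g.
    rewrite (@Rintegral_dmean _ _ _ _ eta
      (fun h z => p (d g @^-1` B `&` d h @^-1` B) z) _ 1).
    + by apply: eq_dmean => h; rewrite Rintegral_disintegration.
    + by move=> h; exact: measurable_fine_disintegration.
    + by move=> h z; exact: p_le1.
  - by move=> g; apply: measurable_dmean => h; exact: measurable_fine_disintegration.
  - by move=> g z; apply: normr_dmean_le => h; exact: p_le1.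
have mpB := measurable_fine_disintegration mB.
have ip : eta.-integrable setT (EFin \o (fun z => p B z)).
  by apply: (@integrable_bounded _ _ _ eta _ 1) => // z; exact: p_le1.
have ip2 : eta.-integrable setT (EFin \o (fun z => p B z ^+ 2)).
  apply: (@integrable_bounded _ _ _ eta _ 1); first exact: measurable_funX.
  by move=> z; rewrite normrX expr_le1// p_le1.
have ic : eta.-integrable setT (EFin \o cst (c ^+ 2)).
  exact: (@integrable_bounded _ _ _ eta (cst (c ^+ 2)) `|c ^+ 2|).
have iq : eta.-integrable setT (EFin \o q) by exact: integrable_bounded q_le1.
have iZ : eta.-integrable setT (EFin \o (fun z => 2 * c * p B z)).
  exact: (integrableZl measurableT (2 * c) ip).
have -> : \int[eta]_z ((p B z - c) ^+ 2) = \int[eta]_z (p B z ^+ 2) - c ^+ 2.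
  transitivity (\int[eta]_z (p B z ^+ 2 - 2 * c * p B z + c ^+ 2)).
    by apply: eq_Rintegral => z _; ring.
  rewrite RintegralD//; last exact: (integrableB measurableT ip2 iZ).
  rewrite RintegralB// RintegralZl// Rintegral_disintegration// Rintegral_prob_cst -/c.
  ring.
rewrite lerD2r /Rintegral fine_le//.
- exact: (integrable_fin_num measurableT ip2).
- exact: (integrable_fin_num measurableT iq).
apply: ae_ge0_le_integral => //.
- by move=> z _; rewrite lee_fin sqr_ge0.
- exact: (measurable_int _ ip2).
- by move=> z _; rewrite lee_fin; have /andP[] : 0 <= q z <= 1;
    [do 2 apply: dmean_itv01 => ?; exact: fine_prob_itv01|].
- exact: (measurable_int _ iq).
- by apply: filterS ae_mp => z mpz _; rewrite lee_fin; exact: sqr_le_autocorr.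
Qed.

End disintegration_invariance.

(** * Convergence in probability on the base space *)

Section asymptotically_likely.
Context (R : realType) d (Z : measurableType d) (eta : probability Z R).
Implicit Types P Q : nat -> Z -> Prop.

(* The exceptional sets are covered by measurable ones, so that no
   measurability of the events is required. *)
Definition likely P := forall kappa : R, 0 < kappa ->
  \forall n \near \oo, exists N : set Z,
    [/\ measurable N, (eta N < kappa%:E)%E & forall z, ~ N z -> P n z].

(** As [Q] does not depend on [n], a single good index gives it off a set of measure below
    [k.+1%:R^-1]; the intersection of these sets over [k] is null. *)
Lemma likely_ae P (Q : Z -> Prop) : likely P -> (forall n z, P n z -> Q z) ->
  {ae eta, forall z, Q z}.
Proof.
move=> lP PQ.
have /choice[N NP] (k : nat) : exists N : set Z,
    [/\ measurable N, (eta N < (k.+1%:R^-1)%:E)%E & forall z, ~ N z -> Q z].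
  have k0 : (0 : R) < k.+1%:R^-1 by rewrite invr_gt0.
  have [n _ /(_ n (leqnn n)) [N [mN Nk NP]]] := lP _ k0.
  by exists N; split => // z /NP; exact: PQ.
exists (\bigcap_k N k); split.
- by apply: bigcapT_measurable => k; case: (NP k).
- apply/eqP; rewrite -measure_le0; apply/lee_addgt0Pr => _/posnumP[eps].
  have [k _ /(_ k (leqnn k)) /= keps] := near_infty_natSinv_lt eps.
  have [mN Nk _] := NP k; rewrite add0e.
  apply: (@le_trans _ _ (eta (N k))); last by rewrite ltW// (lt_trans Nk)// lte_fin.
  apply: le_measure; rewrite ?inE//; last exact: bigcap_inf.
  by apply: bigcapT_measurable => j; case: (NP j).
- move=> z /= nQ k _; apply: contrapT => nN; apply: nQ.
  by have [_ _] := NP k; apply.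
Qed.

Lemma likelyS P Q : likely P -> (\forall n \near \oo, forall z, P n z -> Q n z) ->
  likely Q.
Proof.
move=> lP PQ kappa k0; apply: filterS2 (lP _ k0) PQ => n [N [mN Nk NP]] PQn.
by exists N; split => // z /NP; exact: PQn.
Qed.

Lemma likely_and P Q : likely P -> likely Q -> likely (fun n z => P n z /\ Q n z).
Proof.
move=> lP lQ kappa k0; have k20 : 0 < kappa / 2 by rewrite divr_gt0.
apply: filterS2 (lP _ k20) (lQ _ k20) => n [N [mN Nk NP]] [N' [mN' Nk' NQ]].
exists (N `|` N'); split; first exact: measurableU.
  rewrite (le_lt_trans (measureU2 _ _ _))// (splitr kappa) EFinD lteD//.
by move=> z /not_orP[/NP ? /NQ ?].
Qed.

Lemma likely_forall (I : finType) (P : I -> nat -> Z -> Prop) :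
  (forall i, likely (P i)) -> likely (fun n z => forall i, P i n z).
Proof.
move=> lP; have : likely (fun n z => forall i, i \in enum I -> P i n z).
  elim: (enum I) => [|i s IHs].
    by move=> kappa k0; apply: nearW => n; exists set0; rewrite measure0 lte_fin.
  apply: likelyS (likely_and (lP i) IHs) _; apply: nearW => n z [Pi Ps] j.
  by rewrite inE => /predU1P[->//|/Ps].
move/likelyS; apply; apply: nearW => n z Ps i.
by apply: Ps; rewrite mem_enum.
Qed.

(** Markov's inequality. *)
Lemma likely_lt (f : nat -> Z -> R) (M eps : R) : 0 < eps ->
  (forall n, measurable_fun setT (f n)) -> (forall n z, 0 <= f n z <= M) ->
  \int[eta]_z f n z @[n --> \oo] --> 0 -> likely (fun n z => f n z < eps).
Proof.
move=> eps0 mf fM f0 kappa k0.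
have : \forall n \near \oo, \int[eta]_z f n z < eps * kappa.
  by move/cvgr_lt : f0; apply; rewrite mulr_gt0.
apply: filterS => n fn; exists [set z | eps%:E <= `|(f n z)%:E|]%E.
have mfn : measurable_fun setT (EFin \o f n) by exact/measurable_EFinP.
have mN : measurable [set z | eps%:E <= `|(f n z)%:E|]%E.
  rewrite -[X in measurable X]setTI; apply: emeasurable_fun_c_infty => //.
  exact: measurableT_comp.
split => //.
  have := le_integral_abse eta measurableT mfn eps0; rewrite setTI => le1.
  rewrite -(@lte_pmul2l _ eps%:E)// (le_lt_trans le1)// -EFinM.
  rewrite (eq_integral (EFin \o f n)) => [|z _]; last first.
    by rewrite gee0_abs// lee_fin; have /andP[] := fM n z.
  rewrite -[ltLHS]fineK ?lte_fin//.
  apply: (@integrable_fin_num _ _ _ eta _ measurableT).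
  apply: (@integrable_bounded _ _ _ eta _ M) => // z.
  by have /andP[? ?] := fM n z; rewrite ger0_norm.
move=> z /= /negP; rewrite -ltNge lte_fin ger0_norm//.
by have /andP[] := fM n z.
Qed.

End asymptotically_likely.

(** * Finite-valued maps and weak containment *)

(** A finite Borel partition is handled as the map sending a point to the index of its piece. An
    arbitrary finite index type allows several such maps to be combined into one. *)
Definition measurable_fibers d (X : measurableType d) (T : finType)
  (phi : X -> T) := forall t, measurable (phi @^-1` [set t]).

Definition joint (G X T : Type) (a : G -> X -> X) (phi : X -> T) (g : G)
  (x : X) : T * T := (phi (a g x), phi x).

Lemma joint_preimage1 (G X T : Type) (a : G -> X -> X) (phi : X -> T) g s t :
  joint a phi g @^-1` [set (s, t)] =
  a g @^-1` (phi @^-1` [set s]) `&` phi @^-1` [set t].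
Proof. by apply/seteqP; split => x; rewrite /joint /= => -[-> ->]. Qed.

Section finite_valued_maps.
Context d (X : measurableType d).

Lemma measurable_fibers_preimage (T : finType) (phi : X -> T) (S : set T) :
  measurable_fibers phi -> measurable (phi @^-1` S).
Proof.
move=> mphi; rewrite (_ : phi @^-1` S = \bigcup_(t in S) phi @^-1` [set t]).
  by apply: fin_bigcup_measurable; [exact: finite_finset|move=> t _; exact: mphi].
by rewrite -preimage_bigcup bigcup_imset1 image_id.
Qed.

Lemma measurable_fibers_comp (T : finType) (phi : X -> T) (f : X -> X) :
  measurable_fun setT f -> measurable_fibers phi -> measurable_fibers (phi \o f).
Proof.
move=> mf mphi t; rewrite comp_preimage -[X in measurable X]setTI.
by apply: mf => //; exact: mphi.
Qed.

Lemma measurable_fibers_ffun (I T : finType) (phi : I -> X -> T) :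
  (forall i, measurable_fibers (phi i)) ->
  measurable_fibers (fun x => [ffun i => phi i x]).
Proof.
move=> mphi t.
rewrite (_ : _ @^-1` _ = \bigcap_(i in [set: I]) phi i @^-1` [set t i]).
  by apply: fin_bigcap_measurable; [exact: finite_finset|move=> i _; exact: mphi].
apply/seteqP; split => [x /= <- i _ /=|x /= xt]; first by rewrite ffunE.
by apply/ffunP => i; rewrite ffunE; exact: xt.
Qed.

Lemma measurable_fibers_pair (S T : finType) (phi : X -> S) (psi : X -> T) :
  measurable_fibers phi -> measurable_fibers psi ->
  measurable_fibers (fun x => (phi x, psi x)).
Proof.
move=> mphi mpsi [s t].
rewrite (_ : _ @^-1` _ = phi @^-1` [set s] `&` psi @^-1` [set t]).
  exact: measurableI.
by apply/seteqP; split => [x [<- <-]|x [/= -> ->]].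
Qed.

Lemma prob_preimage_sum (R : realType) (P : probability X R) (T : finType)
    (phi : X -> T) (S : set T) : measurable_fibers phi ->
  fine (P (phi @^-1` S)) = \sum_(t <- enum T | t \in S) fine (P (phi @^-1` [set t])).
Proof.
move=> mphi.
rewrite (_ : phi @^-1` S = \bigcup_(t in S) phi @^-1` [set t]); last first.
  by rewrite -preimage_bigcup bigcup_imset1 image_id.
have fS : finite_set S by exact: finite_finset.
rewrite measure_fin_bigcup//; last by move=> s t _ _ [x [/= <- <-]].
rewrite sum_fine; last by move=> t _; apply: fin_num_measure; exact: mphi.
have e0 t : t \in S -> t \notin enum T -> P (phi @^-1` [set t]) = 0%E.
  by rewrite mem_enum.
by rewrite (bigfs _ (enum_uniq T) e0) set_mem_set.
Qed.

Lemma borel_partition_fibers (k : nat) (phi : X -> 'I_k) :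
  measurable_fibers phi -> borel_partition (fun i => phi @^-1` [set i]).
Proof.
move=> mphi; split => //; first by move=> i j _ _ [x [/= <- <-]].
by apply/seteqP; split => // x _; exists (phi x).
Qed.

Lemma borel_partitionP (k : nat) (A : 'I_k -> set X) : borel_partition A ->
  exists2 phi : X -> 'I_k, measurable_fibers phi &
    forall i, A i = phi @^-1` [set i].
Proof.
move=> [mA tA AT].
have /choice[phi Aphi] x : exists i, A i x.
  by have : setT x by []; rewrite -AT => -[i _ Aix]; exists i.
have Ai i : A i = phi @^-1` [set i].
  apply/seteqP; split => [x Aix|x /= <-//].
  by apply: tA => //; exists x.
by exists phi => // i; rewrite -Ai.
Qed.

Lemma prob_le_symdiff (R : realType) (P : probability X R) (A B D : set X) :
  measurable A -> measurable B -> measurable D -> (forall x, ~ D x -> A x <-> B x) ->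
  `|fine (P A) - fine (P B)| <= fine (P D).
Proof.
move=> mA mB mD AB.
have fP C : measurable C -> P C \is a fin_num by exact: fin_num_measure.
have aux C C' : measurable C -> measurable C' -> (C `<=` C' `|` D) ->
    fine (P C) <= fine (P C') + fine (P D).
  move=> mC mC' CC'; rewrite -fineD ?fP// fine_le ?fP//.
    by rewrite fin_numD !fP.
  rewrite (le_trans _ (measureU2 _ _ _))//.
  by apply: le_measure; rewrite ?inE//; exact: measurableU.
rewrite ler_distl lerBlDr; apply/andP; split; apply: aux => // x Cx;
  by have [|nD] := pselect (D x); [right|left; apply/(AB x nD)].
Qed.

End finite_valued_maps.

Lemma ltr_fine_abse (R : realType) (x y : \bar R) (eps : R) :
  x \is a fin_num -> y \is a fin_num ->
  (`|x - y| < eps%:E)%E = (`|fine x - fine y| < eps).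
Proof. by move=> /fineK {1}<- /fineK {1}<-; rewrite -EFinB. Qed.

(** Weak containment is phrased with images and joint laws with preimages; this conversion is the
    origin of the inverses [(e m)^-1] below. *)
Lemma mp_image (R : realType) (G : groupType) d (X : measurableType d)
    (a : G -> X -> X) (mu : probability X R) g (A : set X) :
  mp_action a mu -> a g @` A = a g^-1%g @^-1` A.
Proof.
move=> mp_a; apply/seteqP; split => [_ [x Ax <-]|x Ax] /=.
  by rewrite -(mp_actM mp_a) mulVg (mp_act1 mp_a).
by exists (a g^-1%g x); rewrite // -(mp_actM mp_a) mulgV (mp_act1 mp_a).
Qed.

Lemma measurable_fibers_joint (R : realType) (G : groupType) d
    (X : measurableType d) (a : G -> X -> X) (mu : probability X R)
    (T : finType) (phi : X -> T) g :
  mp_action a mu -> measurable_fibers phi -> measurable_fibers (joint a phi g).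
Proof.
move=> mp_a mphi; apply: measurable_fibers_pair => //.
by apply: measurable_fibers_comp => //; exact: (mp_measurable mp_a).
Qed.

(** By invariance the correlation of the translates by [g] and [h] depends on [g * h^-1] only, hence
    on one joint law of [phi]. *)
Lemma autocorr_joint (R : realType) (G : groupType) d
    (X : measurableType d) (a : G -> X -> X) (mu : probability X R)
    (T : finType) (phi : X -> T) (S : set T) t :
  mp_action a mu -> measurable_fibers phi ->
  autocorr a mu (phi @^-1` S) t = dmean (fun g => dmean (fun h =>
    fine (mu (joint a phi (g * h^-1)%g @^-1` [set p | S p.1 /\ S p.2]))) t) t.
Proof.
move=> mp_a mphi; apply: eq_dmean => g; apply: eq_dmean => h.
rewrite -[RHS](congr1 fine (mp_preserving mp_a h _)).
  congr (fine (mu _)); apply/seteqP.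
  by split => x /=; rewrite -(mp_actM mp_a) mulgVK.
by apply: measurable_fibers_preimage; exact: (measurable_fibers_joint _ mp_a).
Qed.

Section approximations.
Context (R : realType) (G : groupType).
Context d (X : measurableType d) (a : G -> X -> X) (mu : probability X R).
Context d' (Y : measurableType d') (b : G -> Y -> Y) (nu : probability Y R).
Hypotheses (mp_a : mp_action a mu) (mp_b : mp_action b nu).

(** The map [psi n] meets the requirement for the first [n] group elements with tolerance
    [n.+1%:R^-1]. Each [g] is eventually among them, and every event [S] is a finite union of the
    cells so controlled. *)
Lemma weakly_contained_cvg (e : nat -> G) (T : finType) (phi : X -> T) :
  (forall g, exists n, e n = g) -> weakly_contained a mu b nu ->
  measurable_fibers phi -> exists psi : nat -> Y -> T,
    (forall n, measurable_fibers (psi n)) /\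
    forall g (S : set (T * T)), fine (nu (joint b (psi n) g @^-1` S))
      @[n --> \oo] --> fine (mu (joint a phi g @^-1` S)).
Proof.
move=> e_surj wc mphi.
have mA : borel_partition (fun i => (enum_rank \o phi) @^-1` [set i]).
  apply: borel_partition_fibers => i.
  by rewrite comp_preimage; exact: measurable_fibers_preimage.
have /choice[psi psiP] n : exists psi : Y -> T, measurable_fibers psi /\
    forall g s t, (exists2 i, (i < n)%N & e i = g) ->
    `|fine (nu (joint b psi g @^-1` [set (s, t)])) -
      fine (mu (joint a phi g @^-1` [set (s, t)]))| < n.+1%:R^-1.
  pose F := [set (e i)^-1%g | i in `I_n].
  have fF : finite_set F by apply: finite_image; exact: finite_II.
  have n0 : (0 : R) < n.+1%:R^-1 by rewrite invr_gt0.
  have [B pB Bclose] := wc _ _ mA F fF _ n0.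
  have [psi mpsi BE] := borel_partitionP pB.
  have mpsi' : measurable_fibers (enum_val \o psi : Y -> T).
    move=> t; rewrite comp_preimage; exact: measurable_fibers_preimage.
  exists (enum_val \o psi); split => // g s t [i ilt eig].
  have fg : F g^-1%g by exists i => //=; rewrite eig.
  have rE u : (enum_rank \o phi) @^-1` [set enum_rank u] = phi @^-1` [set u].
    by apply/seteqP; split => x /=; [move/enum_rank_inj|move=> ->].
  have vE u : psi @^-1` [set enum_rank u] = (enum_val \o psi) @^-1` [set u].
    apply/seteqP; split => y /=; first by move=> ->; rewrite enum_rankK.
    by move=> <-; rewrite enum_valK.
  have := Bclose _ fg (enum_rank s) (enum_rank t).
  rewrite !BE (mp_image _ _ mp_a) (mp_image _ _ mp_b) invgK !rE !vE -!joint_preimage1.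
  rewrite ltr_fine_abse; first by rewrite distrC.
  - by apply: fin_num_measure; exact: (measurable_fibers_joint _ mp_a).
  - by apply: fin_num_measure; exact: (measurable_fibers_joint _ mp_b).
exists psi; split => [n|g S]; first by case: (psiP n).
have mj n : measurable_fibers (joint b (psi n) g).
  by apply: (measurable_fibers_joint _ mp_b); case: (psiP n).
rewrite (prob_preimage_sum _ _ (measurable_fibers_joint _ mp_a _))//.
under eq_cvg do rewrite prob_preimage_sum//.
apply: cvg_big => [|[s t] _]; first exact: add_continuous.
have [i eig] := e_surj g.
apply/cvgrPdist_lt => eps eps0.
have small := near_infty_natSinv_lt (PosNum eps0).
apply: filterS2 small (nbhs_infty_gt i) => n neps ilt.
have [_ /(_ g s t (ex_intro2 _ _ i ilt eig))] := psiP n.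
by rewrite distrC => /lt_trans; apply.
Qed.

End approximations.

(** * Concentration of fiber laws and the partitions obtained from it *)

Section ergodic_weak_containment.
Context (R : realType) (G : groupType).
Context (dY : measure_display) (Y : measurableType dY).
Variables (d : G -> Y -> Y) (nu : probability Y R).
Context (dZ : measure_display) (Z : measurableType dZ).
Variables (eta : probability Z R) (pi : Y -> Z) (nuz : Z -> pprobability Y R).
Context (dX : measure_display) (X : measurableType dX).
Variables (a : G -> X -> X) (mu : probability X R) (e : nat -> G).
Hypotheses (mp_d : mp_action d nu) (disint : disintegration nu eta pi nuz).
Hypotheses (ae_mp : {ae eta, forall z, mp_action d (nuz z)}).
Hypotheses (mp_a : mp_action a mu) (ergodic_a : ergodic a mu).
Hypotheses (e_surj : forall g, exists n, e n = g).

Lemma fiber_measure_concentration (T : finType) (phi : X -> T)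
    (psi : nat -> Y -> T) (S : set T) (eps : R) :
  measurable_fibers phi -> (forall n, measurable_fibers (psi n)) ->
  (forall g (S : set (T * T)), fine (nu (joint d (psi n) g @^-1` S))
     @[n --> \oo] --> fine (mu (joint a phi g @^-1` S))) -> 0 < eps ->
  likely eta (fun n z =>
    `|fine (nuz z (psi n @^-1` S)) - fine (mu (phi @^-1` S))| < eps).
Proof.
move=> mphi mpsi psi_phi eps0.
have mE := measurable_fibers_preimage S mphi.
have mEn n := measurable_fibers_preimage S (mpsi n).
have cvgE : fine (nu (psi n @^-1` S)) @[n --> \oo] --> fine (mu (phi @^-1` S)).
  (* The law of a single map is the second marginal of any of its joint laws. *)
  exact: psi_phi 1%g [set p | S p.2].
have cvgA t : autocorr d nu (psi n @^-1` S) t @[n --> \oo] -->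
    autocorr a mu (phi @^-1` S) t.
  rewrite (autocorr_joint _ _ mp_a mphi).
  under eq_cvg do rewrite (autocorr_joint _ _ mp_d (mpsi _)).
  by apply: cvg_dmean => g; apply: cvg_dmean => h; exact: psi_phi.
pose f n z := (fine (nuz z (psi n @^-1` S)) - fine (nu (psi n @^-1` S))) ^+ 2.
have f0 : \int[eta]_z f n z @[n --> \oo] --> (0 : R).
  apply/cvgrPdist_lt => kappa k0.
  (* The mean [t] depends on [kappa] alone. With it fixed, only finitely many correlations must
     converge as [n] grows, and no ergodicity of [nu] is called upon. *)
  have [t] := mean_ergodic mp_a mE e_surj ergodic_a k0.
  rewrite Rintegral_sqr_orbit_mean// -ltrBlDl => tk.
  have : autocorr d nu (psi n @^-1` S) t - fine (nu (psi n @^-1` S)) ^+ 2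
      @[n --> \oo] --> autocorr a mu (phi @^-1` S) t - fine (mu (phi @^-1` S)) ^+ 2.
    rewrite expr2; under eq_cvg do rewrite expr2.
    exact: cvgB (cvgA t) (cvgM cvgE cvgE).
  move=> /cvgr_lt/(_ _ tk).
  apply: filterS => n /= nk.
  rewrite sub0r normrN ger0_norm; last by apply: Rintegral_ge0 => z _; exact: sqr_ge0.
  apply: le_lt_trans nk.
  exact: (variance_disintegration mp_d disint t ae_mp).
(* One half bounds the deviation of the fiber from [nu], the other the distance from [nu] to
   [mu]. *)
have eps20 : 0 < eps / 2 by rewrite divr_gt0.
have sqr0 : 0 < (eps / 2) ^+ 2 by rewrite exprn_gt0.
have fl : likely eta (fun n z => f n z < (eps / 2) ^+ 2).
  apply: (likely_lt (M := 1)) f0 => // [n|n z].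
    apply: measurable_funX; apply: measurable_funB => //.
    exact: (measurable_fine_disintegration disint).
  rewrite sqr_ge0/= /f -real_normK ?num_real// expr_le1//.
  have /andP[? ?] := fine_prob_itv01 (nuz z) (mEn n).
  have /andP[? ?] := fine_prob_itv01 nu (mEn n).
  by rewrite ler_norml; apply/andP; split; lra.
apply: likelyS fl _.
move/cvgrPdist_lt : cvgE => /(_ _ eps20); apply: filterS => n nS z fz.
have {}fz : `|fine (nuz z (psi n @^-1` S)) - fine (nu (psi n @^-1` S))| < eps / 2.
  by rewrite -(@ltr_pXn2r _ 2)// ?nnegrE ?ltW// real_normK ?num_real.
rewrite (splitr eps) (le_lt_trans (ler_distD (fine (nu (psi n @^-1` S))) _ _))//.
by rewrite ltrD// distrC.
Qed.

Lemma fiber_approximation (k N : nat) (alpha : X -> 'I_k) (eps : R) :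
  weakly_contained a mu d nu -> measurable_fibers alpha -> 0 < eps ->
  {ae eta, forall z, exists2 beta : Y -> 'I_k, measurable_fibers beta &
    forall (m : 'I_N) (p : 'I_k * 'I_k),
      `|fine (mu (joint a alpha (e m)^-1%g @^-1` [set p])) -
        fine (nuz z (joint d beta (e m)^-1%g @^-1` [set p]))| < eps}.
Proof.
move=> wc malpha eps0; have eps20 : 0 < eps / 2 by rewrite divr_gt0.
(* The coordinate [None] of [phi] is [alpha] itself, the others are its translates. *)
pose c (o : option 'I_N) : G := if o is Some m then (e m)^-1%g else 1%g.
pose T := {ffun option 'I_N -> 'I_k}.
pose phi x : T := [ffun o => alpha (a (c o) x)].
have mphi : measurable_fibers phi.
  apply: measurable_fibers_ffun => o.
  apply: (measurable_fibers_comp (f := a (c o))) => //.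
  exact: (mp_measurable mp_a).
have [psi [mpsi psi_phi]] := weakly_contained_cvg mp_a mp_d e_surj wc mphi.
pose S (m : 'I_N) (p : 'I_k * 'I_k) : set T := [set q : T | (q (Some m), q None) = p].
(* Here [q.1] is the value at the translated point and [q.2] that at the point, so [off m] says that
   coordinate [Some m] is not the translate of coordinate [None]. This never happens for [phi]. *)
pose off (m : 'I_N) : set (T * T) := [set q : T * T | q.1 None <> q.2 (Some m)].
pose D (m : 'I_N) n : set Y := joint d (psi n) (e m)^-1%g @^-1` off m.
have mD m n : measurable (D m n).
  by apply: measurable_fibers_preimage; exact: (measurable_fibers_joint _ mp_d).
have D0 m : likely eta (fun n z => fine (nuz z (D m n)) < eps / 2).
  apply: (likely_lt (M := 1)) => // [n|n z|].
  - exact: (measurable_fine_disintegration disint).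
  - exact: fine_prob_itv01.
  under eq_cvg do rewrite (Rintegral_disintegration disint)//.
  have := psi_phi (e m)^-1%g (off m).
  have -> : joint a phi (e m)^-1%g @^-1` off m = set0; last by rewrite measure0.
  apply/seteqP; split => x //=.
  by rewrite /off /joint /phi /= !ffunE /= (mp_act1 mp_a).
have S0 m p := fiber_measure_concentration (S m p) mphi mpsi psi_phi eps20.
have := likely_and (likely_forall D0) (likely_forall (fun m => likely_forall (S0 m))).
move/likely_ae; apply => n z [Dn Sn].
have mbeta : measurable_fibers (fun y => psi n y None).
  by move=> i; exact: (measurable_fibers_preimage [set q : T | q None = i]).
exists (fun y => psi n y None) => // m p.
rewrite (splitr eps).
rewrite (le_lt_trans (ler_distD (fine (nuz z (psi n @^-1` S m p))) _ _))// ltrD//.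
  rewrite distrC [X in fine (mu X)](_ : _ = phi @^-1` S m p)//.
  by apply/seteqP; split => x; rewrite /S /joint /phi /= !ffunE /= (mp_act1 mp_a).
(* Off [D m n] the pair formed by [beta] and its translate can be read from the single value
   [psi n y], whose law is already controlled. *)
apply: le_lt_trans (Dn m); apply: prob_le_symdiff => //.
- exact: measurable_fibers_preimage.
- exact: (measurable_fibers_joint _ mp_d).
- move=> y /contrapT /= nD; by rewrite /S /joint /= nD.
Qed.

(* Approximating one map for each table of values rounded to multiples of
   [1 / n.+1] leaves only countably many exceptional null sets. *)
Lemma fiber_approximation_uniform : weakly_contained a mu d nu ->
  {ae eta, forall z k N n (alpha : X -> 'I_k), measurable_fibers alpha ->
    exists2 beta : Y -> 'I_k, measurable_fibers beta &
    forall (m : 'I_N) (p : 'I_k * 'I_k),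
      `|fine (mu (joint a alpha (e m)^-1%g @^-1` [set p])) -
        fine (nuz z (joint d beta (e m)^-1%g @^-1` [set p]))| < 2 / n.+1%:R}.
Proof.
move=> wc; apply: ae_foralln => k; apply: ae_foralln => N; apply: ae_foralln => n.
pose v (alpha : X -> 'I_k) (m : 'I_N) p : R :=
  fine (mu (joint a alpha (e m)^-1%g @^-1` [set p])).
pose table alpha : {ffun 'I_N * ('I_k * 'I_k) -> nat} :=
  [ffun q => Num.truncn (n.+1%:R * v alpha q.1 q.2)].
have : {ae eta, forall z i alpha, measurable_fibers alpha ->
    unpickle i = Some (table alpha) ->
    exists2 beta : Y -> 'I_k, measurable_fibers beta &
    forall m p, `|v alpha m p - fine (nuz z (joint d beta (e m)^-1%g @^-1` [set p]))|
      < 2 / n.+1%:R}.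
  apply: ae_foralln => i.
  have [[alpha [malpha ialpha]]|noalpha] := pselect (exists alpha,
      measurable_fibers alpha /\ unpickle i = Some (table alpha)); last first.
    by apply: aeW => z alpha malpha ialpha; case: noalpha; exists alpha.
  have n0 : (0 : R) < n.+1%:R^-1 by rewrite invr_gt0.
  apply: filterS (fiber_approximation N wc malpha n0) => z [beta mbeta ab] alpha'.
  move=> malpha'; rewrite ialpha => -[tab]; exists beta => // m p.
  (* One [n.+1%:R^-1] is the rounding error between two maps with the same table, the other is the
     error of the approximation found for the representative [alpha]. *)
  rewrite mulr2n mulrDl mul1r (le_lt_trans (ler_distD (v alpha m p) _ _))//.
  rewrite ltrD//; last exact: ab.
  have v0 al : 0 <= n.+1%:R * v al m p by rewrite mulr_ge0// fine_ge0.
  have := congr1 (fun t : {ffun _ -> nat} => t (m, p)) tab; rewrite !ffunE /= => tr.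
  have /andP[lo hi] := truncn_itv (v0 alpha).
  have /andP[lo' hi'] := truncn_itv (v0 alpha').
  rewrite -(ltr_pM2l (ltr0Sn R n)) divff//.
  rewrite -{1}(ger0_norm (ler0n R n.+1)) -normrM mulrBr.
  move: lo hi lo' hi'; rewrite tr -natr1 ltr_norml => *.
  by apply/andP; split; lra.
apply: filterS => z H alpha malpha.
by apply: (H (pickle (table alpha)) alpha malpha); rewrite pickleK.
Qed.

End ergodic_weak_containment.

Theorem theorem3p11 (R : realType) (G : groupType)
    (countableG : countable [set: G])
    (dY : measure_display) (Y : measurableType dY)
    (d : G -> Y -> Y) (nu : probability Y R) (mp_d : mp_action d nu)
    (dZ : measure_display) (Z : measurableType dZ)
    (eta : probability Z R) (borelZ : standard_borel R Z)
    (pi : Y -> Z)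
    (factor_pi : factor_map d nu (@identity_action G Z) eta pi)
    (nuz : Z -> pprobability Y R) (disint : disintegration nu eta pi nuz)
    (dX : measure_display) (X : measurableType dX)
    (a : G -> X -> X) (mu : probability X R) (mp_a : mp_action a mu)
    (ergodic_a : ergodic a mu)
    (a_wc_d : weakly_contained a mu d nu) :
  {ae eta, forall z, mp_action d (nuz z) /\ weakly_contained a mu d (nuz z)}.
Proof.
have [e e_surj] := countable_enum 1%g countableG.
have ae_mp := disintegration_ae_mp_action mp_d borelZ factor_pi disint e_surj.
have ae_wc :=
  fiber_approximation_uniform mp_d disint ae_mp mp_a ergodic_a e_surj a_wc_d.
(* The null set is fixed before the partition, the finite set and the tolerance are given. *)
apply: filterS2 ae_mp ae_wc => z mp_z approx; split=> // k A pA F fF eps eps0.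
have [alpha malpha AE] := borel_partitionP pA.
have /choice[idx idxP] := e_surj.
have /finite_seqP[s sF] := fF.
(* The initial segment of the enumeration of length [N] contains all of [F]. *)
pose N := (\max_(g <- s) idx g).+1.
have eps20 : 0 < eps / 2 by rewrite divr_gt0.
have [n _ /(_ n (leqnn n)) /= neps] := near_infty_natSinv_lt (PosNum eps20).
have [beta mbeta ab] := approx k N n alpha malpha.
exists (fun i => beta @^-1` [set i]); first exact: borel_partition_fibers.
move=> g Fg i j; have gN : (idx g < N)%N.
  by rewrite ltnS; apply: leq_bigmax_seq => //; move: Fg; rewrite sF.
have := ab (Ordinal gN) (i, j); rewrite /= idxP => lt.
rewrite !AE (mp_image _ _ mp_a) (mp_image _ _ mp_z).
rewrite -!joint_preimage1 ltr_fine_abse.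
- by apply: lt_trans lt _; rewrite mulrC -ltr_pdivlMr.
- by apply: fin_num_measure; exact: (measurable_fibers_joint _ mp_a).
- by apply: fin_num_measure; exact: (measurable_fibers_joint _ mp_z).
Qed.
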